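(* Let $A$ be a real $(d\times d)$-matrix, $S(t)=e^{tA}$, let $B$ be a bounded linear operator from a real Hilbert space $H$ into $\mathbb{R}^d$, and let $P=\{P(t)\}_{t\ge0}$ be the Ornstein-Uhlenbeck semigroup associated with $A$ and $B$. Assume that the limit $Q_\infty:=\lim_{t\to\infty}Q_t$ exists in $\mathcal{L}(\mathbb{R}^d)$ and let $\mu_\infty$ be the centred Gaussian measure on $\mathbb{R}^d$ with covariance matrix $Q_\infty$. Then for all $t,s\ge 0$ with $t\neq s$, $$\|P(t)-P(s)\|_{\mathcal{L}(L^1(\mathbb{R}^d,\mu_\infty))}=2.$$
   Context: Here $Q_t=\int_0^t S(s)BB^*S(s)^*\,ds$ for $t\ge0$, and $\mu_t$ is the centred Gaussian measure on $\mathbb{R}^d$ with covariance matrix $Q_t$ (possibly degenerate; $\mu_0=\delta_0$). The Ornstein-Uhlenbeck semigroup is $P(t)f(x)=\int_{\mathbb{R}^d}f(S(t)x+y)\,d\mu_t(y)$ for bounded continuous $f:\mathbb{R}^d\to\mathbb{R}$. The measure $\mu_\infty$ is invariant for $P$, and $P$ extends uniquely to a strongly continuous contraction semigroup on $L^1(\mathbb{R}^d,\mu_\infty)$, again denoted by $P$. $\mathcal{L}(X)$ carries the uniform operator norm.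
   Formalization: The formal theorem additionally assumes that B is not the zero operator; for B = 0 one has Q_∞ = 0, μ_∞ = δ_0 and P(t) = I for all t, so the norm is 0 and the claim as printed fails. *)

(* Defs.v *)
From HB Require Import structures.
From mathcomp Require Import all_boot all_order all_algebra.
From mathcomp Require Import all_classical all_reals all_analysis.

Set Implicit Arguments.
Unset Strict Implicit.
Unset Printing Implicit Defensive.
Import Order.TTheory GRing.Theory Num.Theory.
Import numFieldNormedType.Exports.

Local Open Scope classical_set_scope.
Local Open Scope ring_scope.

Section borel.
Variables (R : realType) (d : nat).

(* R^d is 'cV[R]_d with its Borel sigma-algebra. *)
HB.instance Definition _ :=
  @isMeasurable.Build (sigma_display (@open 'cV[R]_d)) 'cV[R]_d
    <<s @open 'cV[R]_d >> (@sigma_algebra0 _ setT _)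
    (@sigma_algebraC _ _) (@sigma_algebra_bigcup _ setT _).

End borel.

Definition dot (R : realType) (d : nat) (x y : 'cV[R]_d) : R :=
  \sum_(i < d) x i 0 * y i 0.

Definition expmx (R : realType) (d : nat) (A : 'M[R]_d) : 'M[R]_d :=
  limn (series (fun k : nat => (k`!%:R^-1 : R) *: A ^+ k)).

(* A completeNormedModType with such an inner product is a real Hilbert
   space. *)
Record inner_product (R : realType) (H : completeNormedModType R)
    (ip : H -> H -> R) : Prop := InnerProduct {
  ip_sym : forall x y, ip x y = ip y x;
  ip_linear : forall a x y z, ip (a *: x + y) z = a * ip x z + ip y z;
  ip_norm : forall x, ip x x = `|x| ^+ 2 }.

(* By the Riesz theorem exactly one h satisfies the condition when B is linear
   and bounded. *)
Definition adjoint (R : realType) (d : nat) (H : completeNormedModType R)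
    (ip : H -> H -> R) (B : H -> 'cV[R]_d) (x : 'cV[R]_d) : H :=
  get [set h : H | forall k : H, ip k h = dot (B k) x].

(* Matrix of B B^* in the standard basis. *)
Definition BBadj (R : realType) (d : nat) (H : completeNormedModType R)
    (ip : H -> H -> R) (B : H -> 'cV[R]_d) : 'M[R]_d :=
  \matrix_(i, j) B (adjoint ip B (delta_mx j 0)) i 0.

Definition Qmx (R : realType) (d : nat) (H : completeNormedModType R)
    (ip : H -> H -> R) (A : 'M[R]_d) (B : H -> 'cV[R]_d) (t : R) : 'M[R]_d :=
  \matrix_(i, j) \int[@lebesgue_measure R]_(s in `[0, t])
    (expmx (s *: A) *m BBadj ip B *m (expmx (s *: A))^T) i j.

(* normal_prob is not a point mass when its standard deviation is 0. *)
Definition centred_normal (R : realType) (v : R) :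
    set (measurableTypeR R) -> \bar R :=
  if v == 0 then \d_(0 : R) else normal_prob 0 (Num.sqrt v).

Definition centred_gaussian (R : realType) (d : nat)
    (mu : set 'cV[R]_d -> \bar R) (Q : 'M[R]_d) : Prop :=
  Q^T = Q /\
  forall (u : 'cV[R]_d) (V : set (measurableTypeR R)), measurable V ->
    pushforward mu (dot u) V = centred_normal (dot u (Q *m u)) V.

Definition ou (R : realType) (d : nat) (A : 'M[R]_d)
    (mu : R -> probability 'cV[R]_d R) (t : R) (f : 'cV[R]_d -> R)
    (x : 'cV[R]_d) : R :=
  \int[mu t]_y f (expmx (t *: A) *m x + y).

(* P is a strongly continuous contraction semigroup on L^1(muoo) which agrees
   with ou on bounded continuous functions. LspaceType1 has no vector space
   structure in the library, so linearity is stated on representatives. *)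
Record ou_L1 (R : realType) (d : nat) (A : 'M[R]_d)
    (mu : R -> probability 'cV[R]_d R) (muoo : probability 'cV[R]_d R)
    (P : R -> LspaceType1 muoo -> LspaceType1 muoo) : Prop := OuL1 {
  ou_L1_linear : forall t : R, 0 <= t -> forall (a : R) (f g h : LspaceType1 muoo),
    (h : _ -> R) = (fun x => a * f x + g x) %[ae muoo] ->
    (P t h : _ -> R) = (fun x => a * P t f x + P t g x) %[ae muoo];
  ou_L1_contraction : forall t : R, 0 <= t -> forall f : LspaceType1 muoo,
    ('N[muoo]_1[EFin \o P t f] <= 'N[muoo]_1[EFin \o f])%E;
  ou_L1_0 : forall f, P 0 f = f;
  ou_L1_D : forall t s : R, 0 <= t -> 0 <= s -> forall f, P (t + s) f = P t (P s f);
  ou_L1_continuous : forall f : LspaceType1 muoo,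
    ('N[muoo]_1[EFin \o (P t f \- f)%R])%E @[t --> 0^'+] --> 0%E;
  ou_L1_extends : forall t : R, 0 <= t -> forall (f : 'cV[R]_d -> R) (g : LspaceType1 muoo),
    continuous f -> bounded_fun f ->
    (g : _ -> R) = f %[ae muoo] ->
    (P t g : _ -> R) = ou A mu t f %[ae muoo] }.

(* Norm of an operator on L^1(muoo); the value T f is given by a
   representative. *)
Definition L1_opnorm (R : realType) (d : nat) (muoo : probability 'cV[R]_d R)
    (T : LspaceType1 muoo -> 'cV[R]_d -> R) : \bar R :=
  ereal_sup [set ('N[muoo]_1[EFin \o T f])%E
            | f in [set f : LspaceType1 muoo | ('N[muoo]_1[EFin \o f] <= 1)%E]].

(* Main.v *)
Require Import Defs.
From HB Require Import structures.
From mathcomp Require Import all_boot all_order all_algebra.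
From mathcomp Require Import all_classical all_reals all_analysis.
From mathcomp Require Import measurable_realfun.
From mathcomp Require Import ring lra.

Set Implicit Arguments.
Unset Strict Implicit.
Unset Printing Implicit Defensive.
Import Order.TTheory GRing.Theory Num.Theory.
Import numFieldNormedType.Exports.

Local Open Scope classical_set_scope.
Local Open Scope ring_scope.

(** For [v] in [R^d] put [N v = dot v (Qoo *m v)] and
    [f_v x = expR (dot v x - N v / 2)], a probability density with respect to
    [muoo].  Since [muoo] is invariant, completing the square in the Gaussian
    integral gives [P t f_v = f_w] with [w = (expmx (t *: A))^T *m v].  For two
    densities [p] and [q] one has [|p - q| >= p + q - 2 sqrt (p q)], and
    [\int sqrt (f_w f_w') = expR (- N (w - w') / 8)], so that
    [|P t f_v - P s f_v|] has integral at least
    [2 - 2 expR (- N (w - w') / 8)].  Replacing [v] by [k v] multiplies the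
    exponent by [k ^+ 2], and it remains to find [v] with [N (w - w') > 0].  If
    there were none, then [N w = N w'] for all [v], and invariance would force
    [dot v (Q_t *m v) = dot v (Q_s *m v)] for all [v], i.e. [B = 0].  As [f_v] is
    unbounded, [P t] is only evaluated on the truncations of [f_v]. *)

(** * The matrix exponential *)

Lemma cvg_mxP (R : realType) m n (T : Type) (F : set_system T) {FF : Filter F}
    (f : T -> 'M[R]_(m, n)) (l : 'M[R]_(m, n)) :
  (forall i j, f x i j @[x --> F] --> l i j) -> f x @[x --> F] --> l.
Proof.
move=> fl; apply/cvg_ballP => e e0.
have : \forall x \near F, forall i j, ball (l i j) e (f x i j).
  by apply: filter_forall => i; apply: filter_forall => j; move/cvg_ballP : (fl i j); apply.
by apply: filterS => x h; split.
Qed.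

Lemma cvg_sumr (R : realType) (V : normedModType R) n (T : Type)
    (F : set_system T) {FF : Filter F} (f : 'I_n -> T -> V) (l : 'I_n -> V) :
  (forall i, f i x @[x --> F] --> l i) ->
  \sum_i f i x @[x --> F] --> \sum_i l i.
Proof.
by move=> fl; apply: (@cvg_big V 'I_n +%R 0 xpredT _ T F); first exact: add_continuous.
Qed.

Section expmx.
Variables (R : realType) (d : nat) (A : 'M[R]_d).

(** Matrices carry the maximum norm over entries, so each multiplication by [A] costs the norm of
    [A] times the number [d] of summands. *)
Lemma mx_expr_entry_le k i j : `|(A ^+ k) i j| <= (d%:R * `|A|) ^+ k.
Proof.
elim: k i j => [|k ih] i j.
  by rewrite !expr0 mxE; case: (_ == _); rewrite ?normr1 ?normr0.
rewrite !exprS mxE (le_trans (ler_norm_sum _ _ _))//.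
rewrite -mulrA mulr_natl -[X in _ *+ X]card_ord -sumr_const.
apply: ler_sum => l _; rewrite normrM ler_pM//.
by rewrite [leRHS]/Num.norm/= mx_normrE; apply/bigmax_geP; right; exists (i, l).
Qed.

(** Power series coefficients, in x, of the (i, j) entry of A^m exp(x A). The shift [m] makes the
    family closed under termwise differentiation. *)
Definition expmx_coeff m i j (n : nat) : R := (A ^+ (n + m)) i j / n`!%:R.

(** Comparison with the exponential series of C |x|, where C is [d] times the norm of [A],
    multiplied by C^m. *)
Lemma is_cvg_expmx_coeff m i j x : cvgn (pseries (expmx_coeff m i j) x).
Proof.
set C := d%:R * `|A|.
have C0 : 0 <= C by rewrite mulr_ge0.
have AC k : `|(A ^+ k) i j| <= C ^+ k by exact: mx_expr_entry_le.
clearbody C.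
apply: normed_cvg => /=.
apply: (@series_le_cvg _ _ (fun n => C ^+ m * exp_coeff (C * `|x|) n)) => //=.
- by move=> n; rewrite !mulr_ge0 ?exprn_ge0 ?invr_ge0 ?mulr_ge0.
- move=> n; rewrite /expmx_coeff /exp_coeff !normrM normrV ?unitfE ?pnatr_eq0 -?lt0n ?fact_gt0//.
  rewrite (normr_nat _ n`!) normrX.
  apply: (@le_trans _ _ (C ^+ (n + m) / n`!%:R * `|x| ^+ n)).
    rewrite ler_wpM2r ?exprn_ge0//.
    by rewrite ler_wpM2r ?invr_ge0.
  rewrite le_eqVlt; apply/orP; left; apply/eqP.
  by rewrite /= exprD exprMn; ring.
- apply: is_cvg_seriesZ; exact: is_cvg_series_exp_coeff.
Qed.

Lemma expmx_entryE x i j :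
  expmx (x *: A) i j = limn (pseries (expmx_coeff 0 i j) x).
Proof.
pose L : 'M[R]_d := \matrix_(i, j) limn (pseries (expmx_coeff 0 i j) x).
suff -> : expmx (x *: A) = L by rewrite mxE.
apply: cvg_lim => //; apply: cvg_mxP => k l; rewrite mxE.
have <- : pseries (expmx_coeff 0 k l) x =
  (fun n => series (fun n => (n`!%:R^-1 : R) *: (x *: A) ^+ n) n k l).
  apply/funext => n; rewrite /pseries/= /series/= summxE; apply: eq_bigr => p _.
  rewrite /expmx_coeff addn0.
  have -> : (x *: A) ^+ p = x ^+ p *: A ^+ p.
    elim: p => [|p ih]; first by rewrite !expr0 scale1r.
    rewrite !exprS ih.
    by rewrite -[LHS]/((x *: A) *m (x ^+ p *: A ^+ p)) -scalemxAl -scalemxAr scalerA.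
  by rewrite !mxE; ring.
exact: is_cvg_expmx_coeff.
Qed.

Lemma pseries_diffs_expmx m i j :
  pseries_diffs (expmx_coeff m i j) = expmx_coeff m.+1 i j.
Proof.
apply/funext => n; rewrite /pseries_diffs /expmx_coeff addSnnS factS natrM.
by field; rewrite ?nat1r !pnatr_eq0 ?andbT -lt0n fact_gt0.
Qed.

Lemma lim_expmx_coeff1l x i j :
  limn (pseries (expmx_coeff 1 i j) x) = (A *m expmx (x *: A)) i j.
Proof.
rewrite mxE; apply: cvg_lim => //.
have -> : pseries (expmx_coeff 1 i j) x =
    fun n => \sum_k A i k * pseries (expmx_coeff 0 k j) x n.
  apply/funext => n; rewrite /pseries/= /series/=.
  under [in RHS]eq_bigr do rewrite mulr_sumr.
  rewrite exchange_big; apply: eq_bigr => p _ /=.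
  rewrite /expmx_coeff addn1 exprS addn0 mxE !mulr_suml.
  by apply: eq_bigr => k _; ring.
apply: cvg_sumr => k; rewrite expmx_entryE; apply: cvgM; (try exact: cvg_cst).
exact: is_cvg_expmx_coeff.
Qed.

Lemma lim_expmx_coeff1r x i j :
  limn (pseries (expmx_coeff 1 i j) x) = (expmx (x *: A) *m A) i j.
Proof.
rewrite mxE; apply: cvg_lim => //.
have -> : pseries (expmx_coeff 1 i j) x =
    fun n => \sum_k pseries (expmx_coeff 0 i k) x n * A k j.
  apply/funext => n; rewrite /pseries/= /series/=.
  under [in RHS]eq_bigr do rewrite mulr_suml.
  rewrite exchange_big; apply: eq_bigr => p _ /=.
  rewrite /expmx_coeff addn1 exprSr addn0 mxE !mulr_suml.
  by apply: eq_bigr => k _; ring.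
apply: cvg_sumr => k; rewrite expmx_entryE; apply: cvgM; (try exact: cvg_cst).
exact: is_cvg_expmx_coeff.
Qed.

(** Both products are the sum of the series with coefficients [expmx_coeff 1], a factor [A] being
    split off on the left or on the right. *)
Lemma expmx_comm x : A *m expmx (x *: A) = expmx (x *: A) *m A.
Proof. by apply/matrixP => i j; rewrite -lim_expmx_coeff1l lim_expmx_coeff1r. Qed.

Lemma is_derive_expmx x i j :
  is_derive (x : R) (1 : R) (fun x => expmx (x *: A) i j) ((A *m expmx (x *: A)) i j).
Proof.
rewrite -lim_expmx_coeff1l -pseries_diffs_expmx.
rewrite (_ : (fun x => _) = (fun x => limn (pseries (expmx_coeff 0 i j) x))); last first.
  by apply/funext => y; rewrite expmx_entryE.
(* The auxiliary point only has to exceed x in absolute value, as all series involved converge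
   everywhere. *)
apply: (@pseries_snd_diffs _ _ (`|x| + 1)); rewrite ?pseries_diffs_expmx;
  do ?exact: is_cvg_expmx_coeff.
by rewrite [ltRHS]ger0_norm// ltrDl.
Qed.

Lemma continuous_expmx i j : continuous (fun x : R => expmx (x *: A) i j).
Proof.
move=> x; apply: differentiable_continuous; apply/derivable1_diffP.
exact: (@ex_derive _ _ _ _ _ _ _ (is_derive_expmx x i j)).
Qed.

Lemma expmx0 : expmx (0 *: A) = 1%:M.
Proof.
apply/matrixP => i j; rewrite expmx_entryE; apply: cvg_lim => //.
apply/cvg_ballP => e e0; near=> n.
suff -> : pseries (expmx_coeff 0 i j) 0 n = 1%:M i j by exact: ballxx.
(* At 0 only the constant term survives; the empty partial sum has to be avoided. *)
have n0 : (0 < n)%N by near: n; exists 1%N.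
rewrite /pseries/= /series/= big_mkord -(prednK n0) big_ord_recl/= big1.
  by rewrite /expmx_coeff expr0 fact0 !(addr0, mulr1, divr1).
by move=> k _; rewrite exprS mul0r mulr0.
Unshelve. all: by end_near. Qed.

(** By the product rule and [expmx_comm] each entry of the product has derivative zero in x, so it
    keeps its value at 0. *)
Lemma expmxK x : expmx (x *: A) *m expmx (- x *: A) = 1%:M.
Proof.
apply/matrixP => i j.
pose f y := (expmx (y *: A) *m expmx (- y *: A)) i j.
have /(is_derive_0_is_cst x 0) : forall y : R, is_derive y (1 : R) f 0.
  move=> y.
  have -> : f = \sum_k ((fun y : R => expmx (y *: A) i k) *
      ((fun y : R => expmx (y *: A) k j) \o -%R)).
    by apply/funext => z; rewrite /f mxE fct_sumE.
  have dE k : is_derive y (1 : R) ((fun y : R => expmx (y *: A) k j) \o -%R)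
      ((A *m expmx (- y *: A)) k j * -1).
    apply: is_derive1_comp; exact: is_derive_expmx.
  have dS k := is_deriveM (is_derive_expmx y i k) (dE k).
  apply: is_derive_eq (is_derive_sum dS) _.
  under eq_bigr do rewrite mulrN1 scalerN addrC /= /GRing.scale/=.
  rewrite sumrB; apply/eqP; rewrite subr_eq0; apply/eqP.
  transitivity ((A *m expmx (y *: A) *m expmx (- y *: A)) i j).
    by rewrite [RHS]mxE; apply: eq_bigr => k _; rewrite mulrC.
  by rewrite expmx_comm -mulmxA mxE.
by rewrite /f => ->; rewrite oppr0 expmx0 mulmx1.
Qed.
End expmx.

(** * Riesz representation and the adjoint of B *)

Section inner_product.
Variables (R : realType) (H : completeNormedModType R) (ip : H -> H -> R).
Hypothesis hip : inner_product ip.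

Lemma ipDl x y z : ip (x + y) z = ip x z + ip y z.
Proof. by rewrite -[x]scale1r ip_linear// mul1r scale1r. Qed.

Lemma ip0l z : ip 0 z = 0.
Proof. by apply: (addIr (ip 0 z)); rewrite -ipDl !add0r. Qed.

Lemma ipZl a x z : ip (a *: x) z = a * ip x z.
Proof. by rewrite -[a *: x]addr0 ip_linear// ip0l addr0. Qed.

Lemma ipDr x y z : ip z (x + y) = ip z x + ip z y.
Proof. by rewrite ip_sym// ipDl -!(ip_sym hip z). Qed.

Lemma ipZr a x z : ip z (a *: x) = a * ip z x.
Proof. by rewrite ip_sym// ipZl -!(ip_sym hip z). Qed.

Lemma ipNr x z : ip z (- x) = - ip z x.
Proof. by rewrite -scaleN1r ipZr mulN1r. Qed.

Lemma sqr_normD x y : `|x + y| ^+ 2 = `|x| ^+ 2 + ip x y *+ 2 + `|y| ^+ 2.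
Proof. by rewrite -!(ip_norm hip) ipDl !ipDr (ip_sym hip y x); ring. Qed.

Section riesz.
Variable phi : {linear H -> R^o}.
Hypothesis phi_bounded : bounded_near phi (nbhs (0 : H)).

Let phiD x y : phi (x + y) = phi x + phi y :> R.
Proof. exact: linearD. Qed.

Let phiZ a x : phi (a *: x) = a * phi x :> R.
Proof. exact: linearZ. Qed.

(* The representative of [phi] is the minimizer of [J]; minimizing sequences
   are Cauchy by the parallelogram identity [J_mid]. *)
Let J (x : H) : R := `|x| ^+ 2 - phi x *+ 2.

Let J_mid x y : J (2^-1 *: (x + y)) = (J x + J y) / 2 - `|x - y| ^+ 2 / 4.
Proof.
rewrite /J phiZ phiD normrZ exprMn !sqr_normD normrN.
by rewrite ipNr ger0_norm ?invr_ge0//; field.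
Qed.

Let J_lb : has_inf (range J).
Proof.
split; first by exists (J 0), 0.
have /linear_boundedP[M [_ hM]] := phi_bounded.
(* Above the threshold [M] one has |phi x| <= C |x|, hence J x >= (|x| - C)^2 - C^2. *)
pose C := `|M| + 1; have /hM{}hM : M < C by rewrite (le_lt_trans (ler_norm _))// ltrDl.
exists (- C ^+ 2) => _ [x _ <-].
have := hM x; have := ler_norm (phi x); rewrite /J => h1 h2.
have : 0 <= (`|x| - C) ^+ 2 by exact: sqr_ge0.
have := le_trans h1 h2; nra.
Qed.

Let m := inf (range J).

Let J_ge x : m <= J x.
Proof. by apply: ge_inf; [case: J_lb|exists x]. Qed.

Let J_near x y e : J x < m + e -> J y < m + e -> `|x - y| ^+ 2 < 4 * e.
Proof. by have := J_ge (2^-1 *: (x + y)); rewrite J_mid; lra. Qed.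

Lemma riesz_representation : exists h, forall k, ip k h = phi k.
Proof.
have ex n : exists x, J x < m + n.+1%:R^-1.
  have [|_ [x _ <-] ?] := @inf_adherent R (range J) n.+1%:R^-1 _ J_lb; last by exists x.
  by rewrite invr_gt0.
have [u uJ] := choice ex.
have cu : cvg (u @ \oo).
  apply/cauchy_cvgP/cauchy_ballP => e e0; near_simpl.
  (* By [J_near], values of [J] within e^2 / 4 of the infimum keep the points at distance less than
     e. *)
  have : \forall N \near \oo, (N.+1%:R^-1 : R) < e ^+ 2 / 4.
    exact: near_infty_natSinv_lt (PosNum (divr_gt0 (exprn_gt0 2 e0) (ltr0n _ 4))).
  case=> N _ /(_ _ (leqnn N))/= hN.
  have uN n : (N <= n)%N -> J (u n) < m + N.+1%:R^-1.
    move=> Nn; rewrite (lt_le_trans (uJ _))// lerD2l lef_pV2 ?posrE//.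
    by rewrite ler_nat ltnS.
  exists ([set n | (N <= n)%N], [set n | (N <= n)%N]).
    by split; exists N.
  case=> a b [/= /uN Na /uN Nb].
  rewrite -ball_normE /ball_/=.
  rewrite -(ltr_pXn2r (n := 2)) ?nnegrE// ?ltW//.
  rewrite (lt_le_trans (J_near Na Nb))// mulrC -ler_pdivlMr//.
  exact: ltW.
pose h := lim (u @ \oo).
have Jh : J h = m.
  have cphi := (linear_bounded_continuous phi).1 phi_bounded.
  apply/eqP; rewrite eq_le J_ge andbT.
  have uh : J (u n) @[n --> \oo] --> J h.
    apply: cvgB; last by rewrite !mulr2n; apply: cvgD; apply: (cvg_comp _ _ cu); exact: cphi.
    by rewrite !expr2; apply: cvgM; exact: cvg_norm.
  have um : (m + n.+1%:R^-1) @[n --> \oo] --> m.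
    by rewrite -[X in _ --> X]addr0; apply: cvgD; [exact: cvg_cst|exact: cvg_harmonic].
  rewrite -(cvg_lim _ uh)// -[X in _ <= X](cvg_lim _ um)//; apply: ler_lim.
  - by apply/cvg_ex; exists (J h).
  - by apply/cvg_ex; exists m.
  - by apply: nearW => n; exact/ltW.
exists h => k; apply/eqP; rewrite -subr_eq0; set s := _ - _.
(* Moving from the minimizer [h] by - s / D along [k] changes [J] by - s^2 (D + 1) / D^2, which
   forces s = 0. The summand 1 keeps [D] positive when [k] is 0. *)
pose D := `|k| ^+ 2 + 1.
have D0 : 0 < D by rewrite ltr_wpDl ?sqr_ge0.
have := J_ge (h + (- s / D) *: k).
rewrite -Jh /J sqr_normD phiD phiZ ipZr normrZ exprMn real_normK ?num_real// (ip_sym hip h).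
move=> hs.
have : 0 <= - s / D * s *+ 2 + (- s / D) ^+ 2 * `|k| ^+ 2.
  move: hs; rewrite -subr_ge0; congr (is_true (0 <= _)).
  by rewrite /s; ring.
have -> : - s / D * s *+ 2 + (- s / D) ^+ 2 * `|k| ^+ 2 = - (s ^+ 2 * ((D + 1) / D ^+ 2)).
  by rewrite (_ : `|k| ^+ 2 = D - 1); [field; rewrite gt_eqF|rewrite /D addrK].
rewrite oppr_ge0 pmulr_lle0 ?divr_gt0 ?exprn_gt0 ?(addr_gt0 D0)// => s2.
by rewrite -sqrf_eq0 eq_le s2 sqr_ge0.
Qed.
End riesz.
End inner_product.

Section dot.
Variables (R : realType) (d : nat).
Implicit Types x y z : 'cV[R]_d.

Lemma dotE x y : dot x y = (x^T *m y) 0 0.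
Proof. by rewrite mxE; apply: eq_bigr => i _; rewrite mxE. Qed.

Lemma dotC x y : dot x y = dot y x.
Proof. by apply: eq_bigr => i _; rewrite mulrC. Qed.

Lemma dotDl x y z : dot (x + y) z = dot x z + dot y z.
Proof. by rewrite !dotE linearD/= mulmxDl mxE. Qed.

Lemma dotDr x y z : dot z (x + y) = dot z x + dot z y.
Proof. by rewrite dotC dotDl !(dotC z). Qed.

Lemma dotZl a x z : dot (a *: x) z = a * dot x z.
Proof. by rewrite !dotE linearZ/= -scalemxAl mxE. Qed.

Lemma dotZr a x z : dot z (a *: x) = a * dot z x.
Proof. by rewrite dotC dotZl dotC. Qed.

Lemma dot_mulmxr (M : 'M[R]_d) x y : dot x (M *m y) = dot (M^T *m x) y.
Proof. by rewrite !dotE trmx_mul trmxK mulmxA. Qed.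

Lemma dot_delta x i : dot x (delta_mx i 0) = x i 0.
Proof.
rewrite /dot (bigD1 i)//= mxE !eqxx mulr1 big1 ?addr0// => j ji.
by rewrite mxE (negbTE ji) mulr0.
Qed.

Lemma dot_mulmx_sum (M : 'M[R]_d) x :
  dot x (M *m x) = \sum_i \sum_j x i 0 * x j 0 * M i j.
Proof.
apply: eq_bigr => i _; rewrite mxE mulr_sumr; apply: eq_bigr => j _.
by rewrite mulrA mulrAC.
Qed.

Lemma continuous_dot x : continuous (dot x).
Proof.
move=> y; apply: (@cvg_sumr R R^o d _ (nbhs y) _ (fun i z => x i 0 * z i 0)) => i.
by apply: cvgM; [exact: cvg_cst|exact: coord_continuous].
Qed.

End dot.

Section adjoint.
Variables (R : realType) (d : nat) (H : completeNormedModType R).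
Variables (ip : H -> H -> R) (B : {linear H -> 'cV[R]_d}).
Hypotheses (hip : inner_product ip) (hB : bounded_near B (nbhs (0 : H))).

Let Bdot w (k : H) : R^o := dot (B k) w.

Let Bdot_linear w : linear (Bdot w).
Proof. by move=> a x y; rewrite /Bdot linearP dotDl dotZl. Qed.

Let Bdot_lin w : {linear H -> R^o} := HB.pack (Bdot w)
  (GRing.isLinear.Build R H R^o *:%R (Bdot w) (Bdot_linear w)).

(** The functional taking k to [dot (B k) w] is linear and bounded, so its Riesz representative
    exists and the [get] in [adjoint] does not fall back on its default value. *)
Lemma adjointP w k : ip k (adjoint ip B w) = dot (B k) w.
Proof.
have bw : bounded_near (Bdot_lin w) (nbhs (0 : H)).
  apply/linear_bounded_continuous => /= x.
  rewrite (_ : Bdot w = dot w \o B); last by apply/funext => y; exact: dotC.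
  apply: continuous_comp; last exact: continuous_dot.
  exact: ((linear_bounded_continuous B).1 hB).
have [h hk] := riesz_representation hip bw.
by have /getPex : exists h, [set h : H | forall k, ip k h = dot (B k) w] h;
  [exists h|apply].
Qed.

(** Symmetry of [ip] turns the pairing of B B^* e_j with w into coordinate j of B B^* w, and the sum
    over j collapses to the pairing of B B^* w with w. *)
Lemma dot_BBadj w : dot w (BBadj ip B *m w) = `|adjoint ip B w| ^+ 2.
Proof.
rewrite -(ip_norm hip) adjointP.
transitivity (\sum_j w j 0 * dot (B (adjoint ip B (delta_mx j 0))) w).
  rewrite /dot; under [RHS]eq_bigr do rewrite mulr_sumr.
  rewrite exchange_big/=; apply: eq_bigr => i _; rewrite mxE mulr_sumr.
  by apply: eq_bigr => j _; rewrite mxE; ring.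
rewrite dotC; apply: eq_bigr => j _; congr (_ * _).
by rewrite -adjointP (ip_sym hip) adjointP dot_delta.
Qed.

Lemma adjoint_eq0 : (forall w, adjoint ip B w = 0) -> forall h, B h = 0.
Proof.
move=> a0 h; apply/matrixP => i j; rewrite (ord1 j) mxE -dot_delta -adjointP a0.
by rewrite (ip_sym hip) (ip0l hip).
Qed.

End adjoint.

(** * Primitives of nonnegative continuous functions *)

Section primitive.
Variables (R : realType) (g : R -> R).
Hypotheses (cg : continuous g) (g0 : forall x, 0 <= g x).
Let mu := @lebesgue_measure R.
Let F t := \int[mu]_(x in `[0, t]) g x.

Let ig (t : R) : mu.-integrable `[0, t] (EFin \o g).
Proof.
apply: continuous_compact_integrable; first exact: segment_compact.
exact: continuous_subspaceT.
Qed.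

Let F_homo s t : 0 <= s -> s <= t -> F s <= F t.
Proof.
move=> s0 st; rewrite -subr_ge0 /F Rintegral_itvB//.
exact: Rintegral_ge0.
Qed.

(** [F] is nondecreasing, so equal values at s and t make it constant in between, while its
    derivative at the midpoint is [g] there. *)
Lemma continuous_integral_eq0 s t : 0 <= s -> s < t -> F s = F t ->
  g ((s + t) / 2) = 0.
Proof.
move=> s0 st Fst; set x := _ / _.
have /andP[sx xt] : s < x < t by rewrite /x; lra.
have [|dF <-] := @continuous_FTC1_closed R g 0 x t xt (ig t) _ (@cg x).
  exact: le_lt_trans sx.
rewrite derive1E -[RHS](derive_cst (F t) x 1).
apply: near_eq_derive.
have xst : x \in `]s, t[ by rewrite in_itv/= sx xt.
apply: filterS (near_in_itvoo xst) => y; rewrite in_itv/= => /andP[/ltW sy /ltW yt].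
apply/eqP; rewrite eq_le F_homo ?(le_trans s0)//=.
by rewrite /cst -Fst F_homo.
Qed.

End primitive.

(** * The covariance matrices *)

Lemma Rintegral_sum (R : realType) disp (T : measurableType disp)
    (mu : {measure set T -> \bar R}) (D : set T) n (f : 'I_n -> T -> R) :
  measurable D -> (forall i, mu.-integrable D (EFin \o f i)) ->
  \int[mu]_(x in D) (\sum_i f i x) = \sum_i \int[mu]_(x in D) f i x.
Proof.
move=> mD fi.
(* Integrability of the partial sums is carried along in the induction, since additivity of the
   integral needs it. *)
suff [] : mu.-integrable D (EFin \o fun x => \sum_i f i x) /\
  \int[mu]_(x in D) (\sum_i f i x) = \sum_i \int[mu]_(x in D) f i x by [].
rewrite (_ : (fun x => \sum_i f i x) = \sum_i f i); last first.
  by apply/funext => x; rewrite fct_sumE.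
elim/big_ind2 : _ => [|g1 x1 g2 x2 [i1 <-] [i2 <-]|i _].
- by split; [exact: integrable0|rewrite /Rintegral integral0].
- by split; [exact: (integrableD mD i1 i2)|rewrite -RintegralD].
- by split.
Qed.

Section Qmx.
Variables (R : realType) (d : nat) (H : completeNormedModType R).
Variables (ip : H -> H -> R) (A : 'M[R]_d) (B : {linear H -> 'cV[R]_d}).
Hypotheses (hip : inner_product ip) (hB : bounded_near B (nbhs (0 : H))).

Let E (s : R) := expmx (s *: A) *m BBadj ip B *m (expmx (s *: A))^T.

Let continuous_E i j : continuous (fun s => E s i j).
Proof.
rewrite (_ : (fun s => _) = fun s => \sum_k
    (\sum_l expmx (s *: A) i l * BBadj ip B l k) * expmx (s *: A) j k); last first.
  by apply/funext => s; rewrite mxE; apply: eq_bigr => k _; rewrite !mxE.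
move=> s; apply: (@cvg_sumr R R^o) => k; apply: cvgM; last exact: continuous_expmx.
apply: (@cvg_sumr R R^o) => l; apply: cvgM; last exact: cvg_cst.
exact: continuous_expmx.
Qed.

Let dotE_E v s : dot v (E s *m v) = `|adjoint ip B ((expmx (s *: A))^T *m v)| ^+ 2.
Proof. by rewrite -dot_BBadj// -!mulmxA dot_mulmxr. Qed.

Let continuous_dotE v : continuous (fun s => dot v (E s *m v)).
Proof.
rewrite (_ : (fun s => _) = fun s => \sum_i \sum_j v i 0 * v j 0 * E s i j); last first.
  by apply/funext => s; rewrite dot_mulmx_sum.
move=> s; apply: (@cvg_sumr R R^o) => i; apply: (@cvg_sumr R R^o) => j.
by apply: cvgM; [exact: cvg_cst|exact: continuous_E].
Qed.

Let integrable_itv0 (f : R -> R) t : continuous f ->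
  (@lebesgue_measure R).-integrable `[0, t] (EFin \o f).
Proof.
move=> cf; apply: continuous_compact_integrable; first exact: segment_compact.
exact: continuous_subspaceT.
Qed.

(** The quadratic form is a finite linear combination of entries, so it passes under the integral,
    where B B^* turns into a squared norm. *)
Lemma dot_Qmx v t :
  dot v (Qmx ip A B t *m v) = \int[@lebesgue_measure R]_(s in `[0, t])
    `|adjoint ip B ((expmx (s *: A))^T *m v)| ^+ 2.
Proof.
under eq_Rintegral do rewrite -dotE_E dot_mulmx_sum.
have cij i j : continuous (fun s => v i 0 * v j 0 * E s i j).
  by move=> s; apply: cvgM; [exact: cvg_cst|exact: continuous_E].
rewrite dot_mulmx_sum Rintegral_sum//.
  apply: eq_bigr => i _; rewrite Rintegral_sum//.
    apply: eq_bigr => j _; rewrite mxE RintegralZl//.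
    by apply: integrable_itv0; exact: continuous_E.
  by move=> j; apply: integrable_itv0; exact: cij.
move=> i; apply: (integrable_itv0 (f := fun s => \sum_j v i 0 * v j 0 * E s i j)).
by move=> s; apply: (@cvg_sumr R R^o) => j; exact: cij.
Qed.

Lemma dot_Qmx_ge0 v t : 0 <= dot v (Qmx ip A B t *m v).
Proof. by rewrite dot_Qmx; apply: Rintegral_ge0. Qed.

(* If the two quadratic forms agree then [adjoint ip B ((expmx (x *: A))^T *m v)]
   vanishes for all [v] at the midpoint [x] of [s] and [t]. *)
Lemma Qmx_inj s t : (exists h, B h != 0) -> 0 <= s -> 0 <= t -> s != t ->
  exists v, dot v (Qmx ip A B s *m v) != dot v (Qmx ip A B t *m v).
Proof.
move=> [h Bh]; wlog st : s t / s < t.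
  move=> wl s0 t0 nst; have [st|ts|/eqP] := ltgtP s t; last by rewrite (negbTE nst).
    exact: wl.
  by have [|v] := wl _ _ ts t0 s0; [rewrite eq_sym|exists v; rewrite eq_sym].
move=> s0 t0 _; apply: contrapT => /forallNP eqQ.
case/eqP : Bh; apply: (adjoint_eq0 hip hB) => w.
pose x := (s + t) / 2.
pose v := (expmx (- x *: A))^T *m w.
have wE : (expmx (x *: A))^T *m v = w.
  rewrite mulmxA -trmx_mul -{2}[x]opprK.
  by rewrite expmxK trmx1 mul1mx.
apply/eqP; rewrite -normr_eq0 -sqrf_eq0 -wE -dotE_E; apply/eqP.
apply: (@continuous_integral_eq0 R (fun s => dot v (E s *m v))) => //.
  by move=> y; rewrite dotE_E.
have QE r : dot v (Qmx ip A B r *m v) =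
    \int[@lebesgue_measure R]_(s in `[0, r]) dot v (E s *m v).
  by rewrite dot_Qmx; apply: eq_Rintegral => y _; rewrite dotE_E.
by have /negP := eqQ v; rewrite negbK !QE => /eqP.
Qed.

Lemma dot_Qlim_ge0 (Q : 'M[R]_d) v : Qmx ip A B t @[t --> +oo] --> Q -> 0 <= dot v (Q *m v).
Proof.
move=> hQ.
have hl : dot v (Qmx ip A B t *m v) @[t --> +oo] --> dot v (Q *m v).
  rewrite dot_mulmx_sum.
  rewrite (_ : (fun t => _) = fun t => \sum_i \sum_j v i 0 * v j 0 * Qmx ip A B t i j); last first.
    by apply/funext => t; rewrite dot_mulmx_sum.
  apply: (@cvg_sumr R R^o) => i; apply: (@cvg_sumr R R^o) => j.
  apply: cvgM; first exact: cvg_cst.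
  exact: (cvg_comp _ _ hQ (@coord_continuous R d d i j Q)).
rewrite -(cvg_lim _ hl)//; apply: limr_ge; first by apply/cvg_ex; eexists; exact: hl.
by apply: nearW => t; exact: dot_Qmx_ge0.
Qed.

End Qmx.

(** * Gaussian integrals *)

Lemma continuous_measurable_cV (R : realType) d (f : 'cV[R]_d -> R) :
  continuous f -> measurable_fun [set: 'cV[R]_d] f.
Proof.
move=> cf; apply: (measurability _ (RGenOpens.measurableE R)) => _ [_ [a [b ->] <-]].
rewrite setTI; apply: sub_sigma_algebra.
by apply: open_comp; [move=> x _; exact: cf|exact: interval_open].
Qed.

Lemma measurable_dot (R : realType) d (u : 'cV[R]_d) :
  measurable_fun [set: 'cV[R]_d] (dot u).
Proof. by apply: continuous_measurable_cV; exact: continuous_dot. Qed.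

(** The Radon-Nikodym derivative of the normal law and [normal_pdf] have the same integral over
    every measurable set, hence agree almost everywhere. *)
Lemma integral_normal_prob (R : realType) (m s : R) (f : measurableTypeR R -> \bar R) :
  measurable_fun [set: measurableTypeR R] f -> (forall x, 0 <= f x)%E ->
  (\int[normal_prob m s]_x f x =
   \int[@lebesgue_measure R]_x (f x * (normal_pdf m s x)%:E))%E.
Proof.
move=> mf f0.
have nm := normal_prob_dominates m s.
have mpdf : measurable_fun setT (EFin \o normal_pdf m s).
  by apply/measurable_EFinP; exact: measurable_normal_pdf.
pose h := Radon_Nikodym_SigmaFinite.f (normal_prob m s) (@lebesgue_measure R).
have ih : (@lebesgue_measure R).-integrable setT h.
  exact: Radon_Nikodym_SigmaFinite.f_integrable.
have mh := measurable_int _ ih.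
rewrite -(Radon_Nikodym_SigmaFinite.change_of_variables nm f0 measurableT mf).
apply: ge0_ae_eq_integral => //.
- exact: emeasurable_funM.
- exact: emeasurable_funM.
- by move=> x _; rewrite mule_ge0// Radon_Nikodym_SigmaFinite.f_ge0.
- by move=> x _; rewrite mule_ge0// lee_fin normal_pdf_ge0.
have : ae_eq lebesgue_measure setT h (EFin \o normal_pdf m s).
  apply: integral_ae_eq => // E _ mE.
  by rewrite -Radon_Nikodym_SigmaFinite.f_integral.
by apply: filterS => x /(_ I) hx _; rewrite -/(h x) hx.
Qed.

(** Completing the square: multiplying the normal density by e^x moves its mean from 0 to s^2 and
    leaves a constant factor. *)
Lemma integral_exp_normal (R : realType) (s : R) : s != 0 ->
  (\int[normal_prob 0 s]_x (expR x)%:E = (expR (s ^+ 2 / 2))%:E)%E.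
Proof.
move=> s0; rewrite integral_normal_prob//; last first.
  by apply/measurable_EFinP; exact: measurable_expR.
under eq_integral => x _.
  rewrite -EFinM (_ : _ * _ = expR (s ^+ 2 / 2) * normal_pdf (s ^+ 2) s x); last first.
    rewrite !normal_pdfE// /normal_fun mulrCA -expRD mulrCA -expRD; congr (_ * expR _).
    by field.
  rewrite EFinM.
over.
rewrite ge0_integralZl ?integral_normal_pdf ?mule1 ?lee_fin ?expR_ge0//.
  by apply/measurable_EFinP; exact: measurable_normal_pdf.
by move=> x _; rewrite lee_fin normal_pdf_ge0.
Qed.

(** The law of [dot u] under [mu] reduces the integral to the line. Variance zero is treated apart,
    that law being then a point mass. *)
Lemma gaussian_mgf (R : realType) d (mu : probability 'cV[R]_d R) Q u :
  centred_gaussian mu Q -> 0 <= dot u (Q *m u) ->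
  (\int[mu]_x (expR (dot u x))%:E = (expR (dot u (Q *m u) / 2))%:E)%E.
Proof.
move=> [_ muQ] Q0.
have mdu : measurable_fun [set: 'cV[R]_d] (dot u : _ -> measurableTypeR R) := measurable_dot u.
pose X : {RV mu >-> measurableTypeR R} := HB.pack (dot u : _ -> measurableTypeR R)
  (isMeasurableFun.Build _ _ _ _ _ mdu).
have mE : measurable_fun [set: measurableTypeR R] (EFin \o (@expR R)).
  by apply/measurable_EFinP; exact: measurable_expR.
rewrite -[LHS](ge0_integral_distribution X mE); last first.
  by move=> y; rewrite lee_fin expR_ge0.
have [v0|v0] := eqVneq (dot u (Q *m u)) 0.
  rewrite (eq_measure_integral (\d_(0 : measurableTypeR R))).
    by rewrite integral_dirac// diracT mul1e v0 mul0r /= !expR0.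
  by move=> V mV _; apply: etrans (muQ u V mV) _; rewrite /centred_normal v0 eqxx.
set s := Num.sqrt (dot u (Q *m u)).
rewrite (eq_measure_integral (normal_prob 0 s)).
  rewrite integral_exp_normal ?sqr_sqrtr//.
  by rewrite gt_eqF// sqrtr_gt0 lt_neqAle eq_sym v0.
by move=> V mV _; apply: etrans (muQ u V mV) _; rewrite /centred_normal (negbTE v0).
Qed.

(** * The semigroup on bounded continuous functions *)

Section L1_class.
Variables (R : realType) (disp : measure_display) (T : measurableType disp).
Variable mu : {measure set T -> \bar R}.

Lemma measurable_LspaceType1 (g : LspaceType1 mu) : measurable_fun setT (g : T -> R).
Proof. exact: (@measurable_funPT _ _ _ _ (repr (g : {mfun_ mu, T >-> measurableTypeR R}))). Qed.

(** Elements of [LspaceType1] are classes modulo almost everywhere equality, read through a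
    representative; hence the agreement with [f] is only almost everywhere. *)
Lemma L1_class_exists (f : T -> R) : mu.-integrable setT (EFin \o f) ->
  exists g : LspaceType1 mu, (g : T -> R) = f %[ae mu].
Proof.
move=> /integrableP[/measurable_EFinP mf fi].
pose fm : {mfun T >-> measurableTypeR R} :=
  HB.pack f (isMeasurableFun.Build _ _ T (measurableTypeR R) f mf).
pose g : {mfun_ mu, T >-> measurableTypeR R} := (\pi fm)%qT.
have gf : (g : T -> R) = f %[ae mu].
  apply/asboolP; rewrite -[asbool _]/(ae_eq_op mu (repr g) fm) -eqmodE.
  by rewrite reprK.
have fg : finite_norm mu 1 (g : T -> R).
  rewrite /finite_norm Lnorm1 (le_lt_trans _ fi)//.
  rewrite (ge0_ae_eq_integral (g := fun x => `|(f x)%:E|%E))//.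
  - apply: measurableT_comp => //; apply/measurable_EFinP.
    exact: (@measurable_funPT _ _ _ _ (repr g)).
  - by apply: measurableT_comp => //; apply/measurable_EFinP.
  - by apply: filterS gf => x + _ => /= ->.
pose h : LspaceType1 mu := HB.pack g (isFinLebesgue.Build _ _ _ _ _ (lexx 1%E) g fg).
by exists h.
Qed.

End L1_class.

Section truncation.
Variables (R : realType) (disp : measure_display) (T : measurableType disp).
Variable mu : {measure set T -> \bar R}.

Lemma cvg_minr_nat (a : R) : (Num.min a n%:R)%:E @[n --> \oo] --> a%:E.
Proof.
apply: cvg_EFin; first exact: nearW.
apply: cvg_near_cst.
near=> n; rewrite /= min_l//; near: n; exact: nbhs_infty_ger.
Unshelve. all: by end_near. Qed.

(** Monotone convergence: at each x the truncations increase with n and eventually equal f x. *)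
Lemma cvg_integral_min (f : T -> R) : measurable_fun setT f -> (forall x, 0 <= f x) ->
  (\int[mu]_x (Num.min (f x) n%:R)%:E)%E @[n --> \oo] --> (\int[mu]_x (f x)%:E)%E.
Proof.
move=> mf f0.
rewrite (_ : \int[mu]_x (f x)%:E =
  \int[mu]_x (limn (fun n => (Num.min (f x) n%:R)%:E)))%E; last first.
  by apply: eq_integral => x _; apply/esym/cvg_lim => //; exact: cvg_minr_nat.
apply: cvg_monotone_convergence => //.
- by move=> n; apply/measurable_EFinP; exact: measurable_minr.
- by move=> n x _; rewrite lee_fin le_min f0/=.
- move=> x _ a b ab; rewrite lee_fin le_min ge_min lexx/= ge_min orbC.
  by rewrite ler_nat ab.
Qed.

End truncation.

Section bounded.
Variables (R : realType) (disp : measure_display) (T : measurableType disp).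
Variables (m : probability T R) (h : T -> R) (M : R).
Hypotheses (mh : measurable_fun setT h) (h0 : forall x, 0 <= h x <= M).

Lemma bounded_integrable : m.-integrable setT (EFin \o h).
Proof.
apply: measurable_bounded_integrable => //.
  by rewrite ltey_eq fin_num_measure.
exists M; split; first exact: num_real.
move=> y My x _ /=; have /andP[h1 h2] := h0 x.
by rewrite ger0_norm// (le_trans h2)// ltW.
Qed.

Lemma integral_cstB : (\int[m]_x (M - h x)%:E = M%:E - \int[m]_x (h x)%:E)%E.
Proof.
under eq_integral do rewrite EFinB.
rewrite integralB_EFin//; last exact: bounded_integrable.
  by rewrite integral_cst//= probability_setT mule1.
exact: finite_measure_integrable_cst.
Qed.

End bounded.

(** Tonelli's theorem. As [h] is applied to the sum of a function of x and a function of y,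
    measurability on the product space follows from that of the two scalar products. *)
Lemma measurable_integral_shift (R : realType) d (m : probability 'cV[R]_d R)
    (h : R -> R) (u v : 'cV[R]_d) :
  measurable_fun setT h -> (forall z, 0 <= h z) ->
  measurable_fun setT (fun x => \int[m]_y (h (dot u x + dot v y))%:E)%E.
Proof.
move=> mh h0.
apply: (@measurable_fun_fubini_tonelli_F _ _ _ _ R m
  (fun z : 'cV[R]_d * 'cV[R]_d => (h (dot u z.1 + dot v z.2))%:E)); last first.
  by move=> z; rewrite lee_fin.
apply/measurable_EFinP; apply: (measurableT_comp mh).
by apply: measurable_funD; apply: measurableT_comp => //; exact: measurable_dot.
Qed.

Section mass.
Variables (R : realType) (d : nat) (A : 'M[R]_d).
Variables (mu : R -> probability 'cV[R]_d R) (muoo : probability 'cV[R]_d R).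
Variables (P : R -> LspaceType1 muoo -> LspaceType1 muoo) (hP : ou_L1 A mu P).
Variables (t : R) (t0 : 0 <= t).

Let F (f : 'cV[R]_d -> R) x := (\int[mu t]_y (f (expmx (t *: A) *m x + y))%:E)%E.

Let measurable_shift (f : 'cV[R]_d -> R) x : continuous f ->
  measurable_fun setT (fun y => f (expmx (t *: A) *m x + y)).
Proof.
move=> cf; apply: continuous_measurable_cV => y.
apply: (@continuous_comp _ _ _ (fun y => expmx (t *: A) *m x + y) f); last exact: cf.
by apply: (@continuousD R 'cV[R]_d); [exact: cst_continuous|exact: cvg_id].
Qed.

Variables (f : 'cV[R]_d -> R) (M : R).
Hypotheses (cf : continuous f) (f0 : forall x, 0 <= f x <= M).

(** Boundedness makes the extended integral finite, so the real-valued integral defining [ou]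
    coincides with it. *)
Lemma ouE x : (ou A mu t f x)%:E = F f x.
Proof.
rewrite fineK//; apply: integrable_fin_num => //.
apply: (@bounded_integrable _ _ _ _ (fun y => f (expmx (t *: A) *m x + y)) M) => //.
exact: measurable_shift.
Qed.

Lemma L1_class_bounded : exists g : LspaceType1 muoo, (g : _ -> R) = f %[ae muoo].
Proof.
apply: L1_class_exists; apply: bounded_integrable f0.
exact: continuous_measurable_cV.
Qed.

Lemma ou_L1_ae (g : LspaceType1 muoo) : (g : _ -> R) = f %[ae muoo] ->
  (P t g : _ -> R) = ou A mu t f %[ae muoo].
Proof.
apply: (ou_L1_extends hP) => //.
exists M; split; first exact: num_real.
move=> y My x _ /=; have /andP[f1 f2] := f0 x.
by rewrite ger0_norm// (le_trans f2)// ltW.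
Qed.

Lemma L1_norm_ae (g : LspaceType1 muoo) (h : 'cV[R]_d -> R) :
  measurable_fun setT h -> (forall x, 0 <= h x) -> (g : _ -> R) = h %[ae muoo] ->
  ('N[muoo]_1[EFin \o g] = \int[muoo]_x (h x)%:E)%E.
Proof.
move=> mh h0 gh; rewrite Lnorm1; apply: ge0_ae_eq_integral => //.
- apply: measurableT_comp => //; apply/measurable_EFinP.
  exact: measurable_LspaceType1.
- exact/measurable_EFinP.
- by move=> x _; rewrite lee_fin.
- by apply: filterS gh => x + _ => /= ->//; rewrite ger0_norm.
Qed.

Lemma ou_ge0 x : 0 <= ou A mu t f x.
Proof.
rewrite -lee_fin ouE; apply: integral_ge0 => y _; rewrite lee_fin.
by case/andP: (f0 (expmx (t *: A) *m x + y)).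
Qed.

(** The measure [mu t] has mass one, so constants are fixed. *)
Lemma ou_cstB x : ou A mu t (fun x => M - f x) x = M - ou A mu t f x.
Proof.
apply: EFin_inj; rewrite EFinB ouE /F -integral_cstB//; last exact: measurable_shift.
rewrite fineK// integral_cstB//; last exact: measurable_shift.
by rewrite -/(F f x) -ouE.
Qed.

(** For a nonnegative function the integral is the L^1 norm of its class, so this is contractivity
    of [P t] read on the class of [f]. *)
Lemma integral_ou_le : measurable_fun setT (ou A mu t f) ->
  (\int[muoo]_x (ou A mu t f x)%:E <= \int[muoo]_x (f x)%:E)%E.
Proof.
move=> mo; have [g gf] := L1_class_bounded; have Pg := ou_L1_ae gf.
rewrite -(L1_norm_ae _ _ Pg)//; last exact: ou_ge0.
rewrite -(L1_norm_ae _ _ gf)//; last 2 first.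
- exact: continuous_measurable_cV.
- by move=> x; case/andP : (f0 x).
exact: (ou_L1_contraction hP).
Qed.

End mass.

Section invariance.
Variables (R : realType) (d : nat) (A : 'M[R]_d).
Variables (mu : R -> probability 'cV[R]_d R) (muoo : probability 'cV[R]_d R).
Variables (P : R -> LspaceType1 muoo -> LspaceType1 muoo) (hP : ou_L1 A mu P).
Variables (t : R) (t0 : 0 <= t).

(* Contractivity of [P t] on [f] and on [M - f] gives the two inequalities, so
   that invariance does not have to be derived from [Qmx]. *)
Lemma integral_ou (f : 'cV[R]_d -> R) M : continuous f -> (forall x, 0 <= f x <= M) ->
  measurable_fun setT (ou A mu t f) ->
  (\int[muoo]_x (ou A mu t f x)%:E = \int[muoo]_x (f x)%:E)%E.
Proof.
move=> cf f0 mo.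
have mf := continuous_measurable_cV cf.
have c'f : continuous (fun x => M - f x).
  by move=> x; apply: (@continuousB R R^o); [exact: cst_continuous|exact: cf].
have f'0 x : 0 <= M - f x <= M by have /andP[] := f0 x; lra.
have oM x : 0 <= ou A mu t f x <= M.
  by rewrite (ou_ge0 A mu t cf f0)/= -subr_ge0 -(ou_cstB _ _ _ cf f0) (ou_ge0 A mu t c'f f'0).
have mo' : measurable_fun setT (ou A mu t (fun x => M - f x)).
  rewrite (_ : ou _ _ _ _ = fun x => M - ou A mu t f x); first exact: measurable_funB.
  by apply/funext => x; exact: ou_cstB cf f0 _.
have := integral_ou_le hP t0 c'f f'0 mo'.
under [X in (X <= _)%E]eq_integral do rewrite (ou_cstB A mu t cf f0).
have := integral_ou_le hP t0 cf f0 mo.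
rewrite (integral_cstB _ mo oM) (integral_cstB _ mf f0).
rewrite -(fineK (integrable_fin_num measurableT (bounded_integrable muoo mo oM))).
rewrite -(fineK (integrable_fin_num measurableT (bounded_integrable muoo mf f0))).
rewrite -!EFinB !lee_fin => h1 h2; congr EFin; lra.
Qed.

End invariance.

(** * Exponential tilts *)

Lemma gaussian_mgf_shift (R : realType) d (m : probability 'cV[R]_d R) Q u a :
  centred_gaussian m Q -> 0 <= dot u (Q *m u) ->
  (\int[m]_x (expR (a + dot u x))%:E = (expR (a + dot u (Q *m u) / 2))%:E)%E.
Proof.
move=> mQ Q0; under eq_integral do rewrite expRD EFinM.
rewrite ge0_integralZl//.
- by rewrite (gaussian_mgf mQ)// -EFinM -expRD.
- by apply/measurable_EFinP; apply: (measurableT_comp (@measurable_expR R)); exact: measurable_dot.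
Qed.

Section tilt.
Variables (R : realType) (d : nat).
Implicit Types (v x : 'cV[R]_d) (c : R) (n : nat).

(** The constant [c] absorbs the normalization as well as the x-dependent shifts produced by [ou];
    the cap [n] gives the boundedness that [ou_L1_extends] asks for. *)
Definition tilt v c n x : R := Num.min (expR (c + dot v x)) n%:R.

Lemma tilt_bounds v c n x : 0 <= tilt v c n x <= n%:R.
Proof. by rewrite /tilt le_min expR_ge0 ler0n ge_min lexx orbT. Qed.

Lemma continuous_expR_dot v c : continuous (fun x => expR (c + dot v x)).
Proof.
move=> x; apply: (@continuous_comp _ _ _ (fun x => c + dot v x) (@expR R));
  last exact: continuous_expR.
by apply: (@continuousD R R^o); [exact: cst_continuous|exact: continuous_dot].
Qed.

Lemma continuous_tilt v c n : continuous (tilt v c n).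
Proof.
move=> x; apply: (@continuous_min R _ (fun x => expR (c + dot v x)) (cst n%:R)).
  exact: continuous_expR_dot.
exact: cst_continuous.
Qed.

Lemma cvg_integral_tilt (m : probability 'cV[R]_d R) Q v c :
  centred_gaussian m Q -> 0 <= dot v (Q *m v) ->
  (\int[m]_x (tilt v c n x)%:E)%E @[n --> \oo] -->
  (expR (c + dot v (Q *m v) / 2))%:E.
Proof.
move=> mQ Q0; rewrite -(gaussian_mgf_shift _ mQ)//.
apply: cvg_integral_min => [|x]; last exact: expR_ge0.
by apply: continuous_measurable_cV; exact: continuous_expR_dot.
Qed.

End tilt.

Section ou_tilt.
Variables (R : realType) (d : nat) (A : 'M[R]_d).
Variables (mu : R -> probability 'cV[R]_d R) (muoo : probability 'cV[R]_d R).
Variables (P : R -> LspaceType1 muoo -> LspaceType1 muoo) (hP : ou_L1 A mu P).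
Variables (t : R) (t0 : 0 <= t) (Qt Qoo : 'M[R]_d).
Hypotheses (mut : centred_gaussian (mu t) Qt) (Qt0 : forall v, 0 <= dot v (Qt *m v)).
Hypotheses (muooQ : centred_gaussian muoo Qoo) (Qoo0 : forall v, 0 <= dot v (Qoo *m v)).

Let S := expmx (t *: A).

Let tilt_shift v c n x y : tilt v c n (S *m x + y) = tilt v (c + dot (S^T *m v) x) n y.
Proof. by rewrite /tilt dotDr dot_mulmxr addrA. Qed.

Lemma ou_tiltE v c n x : (ou A mu t (tilt v c n) x)%:E =
  (\int[mu t]_y (tilt v (c + dot (S^T *m v) x) n y)%:E)%E.
Proof.
rewrite (ouE A mu t (@continuous_tilt R d v c n) (tilt_bounds v c n)).
by apply: eq_integral => y _; rewrite tilt_shift.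
Qed.

Lemma measurable_ou_tilt v c n : measurable_fun setT (ou A mu t (tilt v c n)).
Proof.
apply/measurable_EFinP.
rewrite (_ : _ \o _ = fun x => (\int[mu t]_y
    (Num.min (expR (c + (dot (S^T *m v) x + dot v y))) n%:R)%:E)%E); last first.
  apply/funext => x; rewrite /= ou_tiltE.
  by apply: eq_integral => y _; rewrite /tilt addrA.
apply: (@measurable_integral_shift _ _ _ (fun z => Num.min (expR (c + z)) n%:R)).
  apply: measurable_minr => //; apply: measurableT_comp; first exact: measurable_expR.
  exact: measurable_funD.
by move=> z; rewrite le_min expR_ge0/=.
Qed.

Lemma cvg_ou_tilt v c x : (ou A mu t (tilt v c n) x)%:E @[n --> \oo] -->
  (expR (c + dot (S^T *m v) x + dot v (Qt *m v) / 2))%:E.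
Proof.
under eq_cvg do rewrite ou_tiltE.
exact: (@cvg_integral_tilt _ _ _ _ v (c + dot (S^T *m v) x) mut (Qt0 v)).
Qed.

Lemma ou_tilt_homo v c x m n : (m <= n)%N ->
  ou A mu t (tilt v c m) x <= ou A mu t (tilt v c n) x.
Proof.
move=> mn; rewrite -lee_fin !ou_tiltE; apply: ge0_le_integral => //.
- by move=> y _; rewrite lee_fin; case/andP: (tilt_bounds v (c + dot (S^T *m v) x) m y).
- by apply/measurable_EFinP; apply: continuous_measurable_cV; exact: continuous_tilt.
- by apply/measurable_EFinP; apply: continuous_measurable_cV; exact: continuous_tilt.
- move=> y _; rewrite lee_fin le_min ge_min lexx/= ge_min orbC.
  by rewrite ler_nat mn.
Qed.

(** The images of the truncations under [ou] increase with n, so each lies below the limit in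
    [cvg_ou_tilt]. *)
Lemma ou_tilt_le v c n x : ou A mu t (tilt v c n) x <=
  expR (c + dot (S^T *m v) x + dot v (Qt *m v) / 2).
Proof.
rewrite -lee_fin -(cvg_lim _ (@cvg_ou_tilt v c x))//.
apply: lime_ge; first by apply/cvg_ex; eexists; exact: cvg_ou_tilt.
by near=> m; rewrite lee_fin; apply: ou_tilt_homo; near: m; exact: nbhs_infty_ge.
Unshelve. all: by end_near. Qed.

Lemma integral_ou_tilt v c n :
  (\int[muoo]_x (ou A mu t (tilt v c n) x)%:E = \int[muoo]_x (tilt v c n x)%:E)%E.
Proof.
apply: (integral_ou hP t0 (@continuous_tilt R d v c n) (tilt_bounds v c n)).
exact: measurable_ou_tilt.
Qed.

(** This is Q_oo = Q_t + S(t) Q_oo S(t)^* as an identity of quadratic forms. By invariance a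
    truncated exponential and its image under [ou] have the same integral against [muoo]; in the
    limit the exponents must agree. *)
Lemma variance_decomposition v :
  dot v (Qt *m v) + dot (S^T *m v) (Qoo *m (S^T *m v)) = dot v (Qoo *m v).
Proof.
have h1 := @cvg_integral_tilt _ _ _ _ v 0 muooQ (Qoo0 v).
have h2 : (\int[muoo]_x (ou A mu t (tilt v 0 n) x)%:E)%E @[n --> \oo] -->
    (expR (dot v (Qt *m v) / 2 + dot (S^T *m v) (Qoo *m (S^T *m v)) / 2))%:E.
  rewrite -(@gaussian_mgf_shift _ _ _ _ (S^T *m v) (dot v (Qt *m v) / 2) muooQ (Qoo0 _)).
  rewrite (_ : \int[muoo]_x _ =
      \int[muoo]_x (limn (fun n => (ou A mu t (tilt v 0 n) x)%:E)))%E; last first.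
    apply: eq_integral => x _; rewrite (cvg_lim _ (@cvg_ou_tilt v 0 x))//.
    by rewrite add0r addrC.
  apply: cvg_monotone_convergence => //.
  - by move=> n; apply/measurable_EFinP; exact: measurable_ou_tilt.
  - by move=> n x _; rewrite lee_fin
      (ou_ge0 A mu t (@continuous_tilt R d v 0 n) (tilt_bounds v 0 n)).
  - by move=> x _ m n mn; rewrite lee_fin; exact: ou_tilt_homo.
rewrite (_ : (fun n => _) = fun n => \int[muoo]_x (tilt v 0 n x)%:E)%E in h2; last first.
  by apply/funext => n; rewrite integral_ou_tilt.
have := cvg_lim (@ereal_hausdorff R) h1; rewrite (cvg_lim (@ereal_hausdorff R) h2).
by move=> /(_ _)[] /(@expR_inj R); lra.
Qed.

End ou_tilt.

(** * Bounds for the norm of the difference *)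

(** Here p + q - |p - q| is twice the minimum of p and q, which is at most the geometric mean of e^a
    and e^b. Only upper bounds on p and q enter, so the estimate applies to truncations. *)
Lemma add_le_norm_sub_expR (R : realType) (p q a b : R) : p <= expR a -> q <= expR b ->
  p + q <= `|p - q| + 2 * expR ((a + b) / 2).
Proof.
move=> pa qb; have : p <= expR ((a + b) / 2) \/ q <= expR ((a + b) / 2).
  have [ab|/ltW ab] := leP a b.
    by left; rewrite (le_trans pa)// ler_expR; lra.
  by right; rewrite (le_trans qb)// ler_expR; lra.
have [pq|/ltW pq] := leP p q; first rewrite ler0_norm ?subr_le0//.
  by case=> ?; lra.
by rewrite ger0_norm ?subr_ge0//; case=> ?; lra.
Qed.

(** The inequality is kept in additive form because the integrals may be infinite. *)
Lemma integralD_le_norm_sub (R : realType) disp (T : measurableType disp)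
    (m : {measure set T -> \bar R}) (p q e : T -> R) :
  measurable_fun setT p -> measurable_fun setT q -> measurable_fun setT e ->
  (forall x, 0 <= p x) -> (forall x, 0 <= q x) -> (forall x, 0 <= e x) ->
  (forall x, p x + q x <= `|p x - q x| + 2 * e x) ->
  (\int[m]_x (p x)%:E + \int[m]_x (q x)%:E <=
   \int[m]_x `|p x - q x|%:E + 2%:E * \int[m]_x (e x)%:E)%E.
Proof.
move=> mp mq me p0 q0 e0 pqe.
have md : measurable_fun setT (fun x => `|p x - q x|).
  by apply: measurableT_comp => //; exact: measurable_funB.
have m2e : measurable_fun setT (fun x => 2 * e x) by exact: measurable_funM.
have -> : (2%:E * \int[m]_x (e x)%:E = \int[m]_x (2 * e x)%:E)%E.
  rewrite -ge0_integralZl//; first exact/measurable_EFinP.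
  by move=> x _; rewrite lee_fin.
rewrite -!ge0_integralD//; last first.
  all: do ?[by move=> x _; rewrite lee_fin ?mulr_ge0|exact/measurable_EFinP].
apply: ge0_le_integral => //.
- by move=> x _; rewrite -EFinD lee_fin addr_ge0.
- by apply: emeasurable_funD; exact/measurable_EFinP.
- by apply: emeasurable_funD; exact/measurable_EFinP.
- by move=> x _; rewrite -!EFinD lee_fin.
Qed.

Section separation.
Variables (R : realType) (d : nat) (A : 'M[R]_d).
Variables (mu : R -> probability 'cV[R]_d R) (muoo : probability 'cV[R]_d R).
Variables (P : R -> LspaceType1 muoo -> LspaceType1 muoo) (hP : ou_L1 A mu P).
Variables (Q : R -> 'M[R]_d) (Qoo : 'M[R]_d).
Hypotheses (muQ : forall t, 0 <= t -> centred_gaussian (mu t) (Q t)).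
Hypothesis Q0 : forall t v, 0 <= dot v (Q t *m v).
Hypotheses (muooQ : centred_gaussian muoo Qoo) (Qoo0 : forall v, 0 <= dot v (Qoo *m v)).
Variables (t s : R) (t0 : 0 <= t) (s0 : 0 <= s).

Let N v := dot v (Qoo *m v).
Let T := L1_opnorm (fun f => P t f \- P s f).

Let N_parallelogram v w : N (v + w) + N (v - w) = N v * 2 + N w * 2.
Proof.
rewrite /N -[- w]scaleN1r !(mulmxDr, dotDl, dotDr) -!scalemxAr !(dotZl, dotZr).
by ring.
Qed.

Let NZ a v : N (a *: v) = a ^+ 2 * N v.
Proof. by rewrite /N -scalemxAr dotZl dotZr mulrA. Qed.

(** With a, b, c, e standing for N (w + w'), N (w - w'), N w, N w', the left side is the exponent of
    the integral of sqrt (f_w f_w'). *)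
Let expo_Hellinger (a b c e : R) : a + b = c * 2 + e * 2 ->
  - (c + e) / 4 + 2^-1 ^+ 2 * a / 2 = - b / 8.
Proof. by move=> h; lra. Qed.

(** Here a, b, c stand for N v, N w, N w' and e, f for [dot w x], [dot w' x]: the exponent of sqrt
    (f_w f_w') is the mean of the exponents bounding the two images of a tilt. *)
Let expo_mean (a b c e f : R) : - (b + c) / 4 + 2^-1 * (e + f) =
  ((- (a / 2) + e + (a - b) / 2) + (- (a / 2) + f + (a - c) / 2)) / 2.
Proof. by field. Qed.

(** With z = v - w and N z = 0, [N] is affine in a along w + a z; being nonnegative, it must have
    slope b = 0. *)
Lemma seminorm_eq v w : N (v - w) = 0 -> N v = N w.
Proof.
rewrite -[in N v = N w](subrK w v); move: (v - w) => z Nz.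
pose b := dot w (Qoo *m z) + dot z (Qoo *m w).
have Nwz a : N (w + a *: z) = N w + a * b.
  rewrite -[RHS]addr0 -(mulr0 (a ^+ 2)) -Nz /N /b.
  rewrite !(mulmxDr, dotDl, dotDr) -!scalemxAr !(dotZl, dotZr).
  by ring.
suff b0 : b = 0.
  by have := Nwz 1; rewrite b0 scale1r mulr0 addr0 addrC.
(* If b were nonzero, this multiple of z would give [N] the value -1. *)
have := Qoo0 (w + (- (N w + 1) / b) *: z); rewrite -/(N _) Nwz.
have [//|b0] := eqVneq b 0.
by rewrite divfK//; lra.
Qed.

Lemma L1_opnorm_ub : (T <= 2%:E)%E.
Proof.
apply: ge_ereal_sup => _ [f f1 <-].
have mP r : measurable_fun setT (P r f : _ -> R) by exact: measurable_LspaceType1.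
have := @eminkowski _ _ _ muoo (P t f) (\- (P s f : _ -> R)) 1%E (mP t).
have -> : ('N[muoo]_1[EFin \o (\- (P s f : _ -> R))%R] = 'N[muoo]_1[EFin \o P s f])%E.
  by rewrite !Lnorm1; apply: eq_integral => x _ /=; rewrite normrN.
move=> /(_ _ _)/le_trans -> //; first exact: measurable_funN.
rewrite (_ : 2%:E = 1%:E + 1%:E)%E//.
by rewrite leeD// (le_trans (ou_L1_contraction hP _ _)).
Qed.

Lemma L1_opnorm_lb v :
  (2%:E <= T + (2 * expR (- N ((expmx (t *: A))^T *m v - (expmx (s *: A))^T *m v) / 8))%:E)%E.
Proof.
set w := _ *m v; set w' := _ *m v.
(* This constant gives the untruncated exponential integral one against [muoo]. *)
pose c := - (N v / 2).
pose f n := tilt v c n.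
have cf n : continuous (f n) := @continuous_tilt R d v c n.
have f0 n := tilt_bounds v c n.
have If : (\int[muoo]_x (f n x)%:E)%E @[n --> \oo] --> 1%:E.
  rewrite -[X in _ --> X%:E]expR0 -(_ : c + N v / 2 = 0); last by rewrite addNr.
  exact: (@cvg_integral_tilt _ _ _ _ v c muooQ (Qoo0 v)).
(* Integral at most one makes the truncations admissible in the supremum defining [T]. *)
have If1 n : (\int[muoo]_x (f n x)%:E <= 1)%E.
  rewrite -[X in (_ <= X%:E)%E]expR0 -(_ : c + N v / 2 = 0); last by rewrite addNr.
  rewrite -(gaussian_mgf_shift _ muooQ (Qoo0 v)); apply: ge0_le_integral => //.
  - by move=> x _; rewrite lee_fin; case/andP: (f0 n x).
  - by apply/measurable_EFinP; apply: continuous_measurable_cV.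
  - apply/measurable_EFinP; apply: continuous_measurable_cV.
    exact: continuous_expR_dot.
  - by move=> x _; rewrite lee_fin ge_min lexx.
(* [expR (a x)] is sqrt (f_w f_w') at x. *)
pose a x := - (N w + N w') / 4 + dot (2^-1 *: (w + w')) x.
have Ia : (\int[muoo]_x (expR (a x))%:E = (expR (- N (w - w') / 8))%:E)%E.
  rewrite (gaussian_mgf_shift _ muooQ (Qoo0 _)) -/(N _) NZ; congr (expR _)%:E.
  exact: expo_Hellinger (N_parallelogram w w').
have ma : measurable_fun setT (fun x => expR (a x)).
  by apply: continuous_measurable_cV; exact: continuous_expR_dot.
(* The variance decomposition turns the exponent of the bound in [ou_tilt_le] into dot w x - N w /
   2, that of f_w; likewise for s and w'. *)
have qt : dot v (Q t *m v) = N v - N w.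
  apply: (addIr (N w)); rewrite subrK.
  exact: (variance_decomposition hP t0 (muQ t0) (Q0 t) muooQ Qoo0 v).
have qs : dot v (Q s *m v) = N v - N w'.
  apply: (addIr (N w')); rewrite subrK.
  exact: (variance_decomposition hP s0 (muQ s0) (Q0 s) muooQ Qoo0 v).
have hb n x : ou A mu t (f n) x + ou A mu s (f n) x <=
    `|ou A mu t (f n) x - ou A mu s (f n) x| + 2 * expR (a x).
  have ht : ou A mu t (f n) x <= expR (c + dot w x + (N v - N w) / 2).
    by rewrite -qt; exact: (ou_tilt_le A (muQ t0) (Q0 t) v c n x).
  have hs : ou A mu s (f n) x <= expR (c + dot w' x + (N v - N w') / 2).
    by rewrite -qs; exact: (ou_tilt_le A (muQ s0) (Q0 s) v c n x).
  rewrite (_ : a x = (c + dot w x + (N v - N w) / 2 + (c + dot w' x + (N v - N w') / 2)) / 2).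
    exact: add_le_norm_sub_expR ht hs.
  rewrite /a dotZl dotDl.
  exact: (expo_mean (N v) (N w) (N w') (dot w x) (dot w' x)).
have lb n : (2%:E * \int[muoo]_x (f n x)%:E <= T + (2 * expR (- N (w - w') / 8))%:E)%E.
  have mt : measurable_fun setT (ou A mu t (f n)) := measurable_ou_tilt A mu t v c n.
  have ms : measurable_fun setT (ou A mu s (f n)) := measurable_ou_tilt A mu s v c n.
  have [g gf] := L1_class_bounded muoo (cf n) (f0 n).
  have gt := ou_L1_ae hP t0 (cf n) (f0 n) gf.
  have gs := ou_L1_ae hP s0 (cf n) (f0 n) gf.
  have Tg : (\int[muoo]_x `|ou A mu t (f n) x - ou A mu s (f n) x|%:E <= T)%E.
    apply: ereal_sup_ge; exists ('N[muoo]_1[EFin \o (P t g \- P s g)%R])%E.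
      exists g => //=; rewrite (L1_norm_ae _ _ gf)//; last by move=> x; case/andP: (f0 n x).
      exact: continuous_measurable_cV.
    rewrite Lnorm1 le_eqVlt; apply/orP; left; apply/eqP.
    apply: ge0_ae_eq_integral => //.
    - apply/measurable_EFinP.
      exact: (measurableT_comp (@normr_measurable R setT) (measurable_funB mt ms)).
    - apply: measurableT_comp => //; apply/measurable_EFinP.
      by apply: measurable_funB; exact: measurable_LspaceType1.
    - by apply: filterS2 gt gs => x /(_ I) + /(_ I) + _ => /= -> ->.
  apply: (le_trans _ (leeD Tg (lexx _))).
  (* By invariance both integrals on the left of this estimate equal that of [f n], whence the
     factor 2. *)
  have := integralD_le_norm_sub muoo mt ms ma (ou_ge0 A mu t (cf n) (f0 n))
    (ou_ge0 A mu s (cf n) (f0 n)) (fun x => expR_ge0 (a x)) (hb n).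
  rewrite (integral_ou_tilt hP t0 v c n).
  rewrite (integral_ou_tilt hP s0 v c n).
  rewrite Ia -EFinM; apply: le_trans.
  by rewrite -[X in (X * _)%E]/((1 + 1)%:E)%E EFinD ge0_muleDl// mul1e.
have cl : (2%:E * \int[muoo]_x (f n x)%:E)%E @[n --> \oo] --> 2%:E.
  by rewrite -[X in _ --> X]mule1; apply: cvgeZl.
rewrite -(cvg_lim (@ereal_hausdorff R) cl); apply: lime_le; last exact: nearW.
by apply/cvg_ex; exists 2%:E.
Qed.

End separation.

(** From 1 + x <= exp x at x = 2 / e. *)
Lemma expR_small (R : realType) (e : R) : 0 < e -> 2 * expR (- (2 / e)) <= e.
Proof.
move=> e0; have h : 2 / e <= expR (2 / e) by rewrite (le_trans _ (expR_ge1Dx _))// lerDr.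
by rewrite expRN ler_pdivrMr ?expR_gt0// mulrC -ler_pdivrMr.
Qed.

Theorem theorem3p4 (R : realType) (d : nat) (A : 'M[R]_d)
    (H : completeNormedModType R) (ip : H -> H -> R) (hip : inner_product ip)
    (B : {linear H -> 'cV[R]_d}) (hB : bounded_near B (nbhs (0 : H)))
    (B0 : exists h : H, B h != 0)
    (Qoo : 'M[R]_d) (hQ : Qmx ip A B t @[t --> +oo] --> Qoo)
    (mu : R -> probability 'cV[R]_d R)
    (hmu : forall t : R, 0 <= t -> centred_gaussian (mu t) (Qmx ip A B t))
    (muoo : probability 'cV[R]_d R) (hmuoo : centred_gaussian muoo Qoo)
    (P : R -> LspaceType1 muoo -> LspaceType1 muoo) (hP : ou_L1 A mu P)
    (t s : R) (t0 : 0 <= t) (s0 : 0 <= s) (ts : t != s) :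
  L1_opnorm (fun f => P t f \- P s f) = 2%:E.
Proof.
have Q0 r v : 0 <= dot v (Qmx ip A B r *m v) by exact: (dot_Qmx_ge0 A hip hB v r).
have Qoo0 v : 0 <= dot v (Qoo *m v) by exact: (dot_Qlim_ge0 hip hB v hQ).
have [v Qv] := Qmx_inj A hip hB B0 t0 s0 ts.
have vt := variance_decomposition hP t0 (hmu t t0) (Q0 t) hmuoo Qoo0 v.
have vs := variance_decomposition hP s0 (hmu s s0) (Q0 s) hmuoo Qoo0 v.
set w := (expmx (t *: A))^T *m v in vt; set w' := (expmx (s *: A))^T *m v in vs.
have ww' : 0 < dot (w - w') (Qoo *m (w - w')).
  rewrite lt_neqAle Qoo0 andbT eq_sym; apply: contra Qv => /eqP.
  (* If N w = N w', the two variance decompositions make the forms of Q_t and Q_s agree at v,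
     against the choice of v. *)
  move=> /(seminorm_eq Qoo0) eN; apply/eqP.
  by apply: (addIr (dot w (Qoo *m w))); rewrite vt eN vs.
apply/eqP; rewrite eq_le (L1_opnorm_ub hP t0 s0)/=.
apply/lee_addgt0Pr => e e0.
set D := dot _ _ in ww'.
(* Scaling v by k multiplies [D] by k^2; this k makes the exponent in the lower bound equal to - (2
   / e), as in [expR_small]. *)
pose k := Num.sqrt (8 * (2 / e) / D).
have k2 : k ^+ 2 * D / 8 = 2 / e.
  rewrite sqr_sqrtr ?divr_ge0 ?mulr_ge0 ?invr_ge0 ?ltW//.
  by field; rewrite !gt_eqF.
have := L1_opnorm_lb hP hmu Q0 hmuoo Qoo0 t0 s0 (k *: v).
move/le_trans; apply; rewrite leeD2l// lee_fin.
rewrite -!scalemxAr -scalerBr -/w -/w' -scalemxAr dotZl dotZr mulrA -expr2 mulNr -/D k2.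
exact: expR_small.
Qed.
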